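(* Let $n\ge 1$ be an integer and let $\rho,\nu\in\mathcal{D}(\mathbb{C}^n)$ be normalized quantum states. Let $\mathbf{X}=\{(x,y)\in\mathbb{C}^n\times\mathbb{C}^n:\|x\|=\|y\|=1\}$, let $\mathcal{M}(\mathbf{X})$ be the set of finite positive Borel measures supported on $\mathbf{X}$, and let $$f(x,\overline{x},y,\overline{y})=\mathrm{Tr}\left[(xx^*-yy^* )\,\overline{(xx^*-yy^* )}\right],$$ where the overline denotes the entrywise complex conjugate. Define $$P(\rho,\nu)=\inf\left\{\int_{\mathbf{X}} f\,d\mu \;:\; \mu\in\mathcal{M}(\mathbf{X}),\ \int_{\mathbf{X}} xx^*\,d\mu=\rho,\ \int_{\mathbf{X}} yy^*\,d\mu=\nu\right\}$$ and $$D(\rho,\nu)=\sup\left\{\mathrm{Tr}(\rho\Lambda+\nu\Gamma)\;:\;\Lambda,\Gamma\in\mathbb{C}^{n\times n},\ \Lambda^*=\Lambda,\ \Gamma^*=\Gamma,\ f-x^*\Lambda x-y^*\Gamma y\ge 0\ \text{ on }\mathbf{X}\right\}.$$ Then the value of $P(\rho,\nu)$ is attained, and $$W_2^2(\rho,\nu)=P(\rho,\nu)=D(\rho,\nu),$$ where $W_2(\rho,\nu)$ is the order $2$ quantum Wasserstein distance between $\rho$ and $\nu$ and $W_2^2(\rho,\nu)$ denotes its square.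
   Context: For a complex matrix $A$, $A^*$ denotes its conjugate transpose, $\overline{A}$ its entrywise complex conjugate (without transposition) and $\mathrm{Tr}$ the trace; $\|\cdot\|$ is the Euclidean norm on $\mathbb{C}^n$. Vectors of $\mathbb{C}^n$ are column vectors, so $xx^*$ is an $n\times n$ matrix. Integrals of matrix-valued functions are taken entrywise. $\mathcal{D}(\mathbb{C}^n)$ is the set of normalized quantum states, i.e. Hermitian positive semidefinite matrices in $\mathbb{C}^{n\times n}$ with trace $1$. Expanded, the cost is $f(x,\overline{x},y,\overline{y})=\left|\sum_{i=1}^n x_i^2\right|^2+\left|\sum_{i=1}^n y_i^2\right|^2-2\left|\sum_{i=1}^n x_iy_i\right|^2$. A quantum transport plan between $\rho,\nu\in\mathcal{D}(\mathbb{C}^n)$ is a finite set of triples $\{(\omega_\ell,u_\ell,v_\ell)\}_\ell$ with $\omega_\ell>0$, $\sum_\ell\omega_\ell=1$, $u_\ell,v_\ell\in\mathbb{C}^n$, $\|u_\ell\|=\|v_\ell\|=1$, such that $\sum_\ell\omega_\ell u_\ell u_\ell^*=\rho$ and $\sum_\ell\omega_\ell v_\ell v_\ell^*=\nu$. The set of all such plans is $Q(\rho,\nu)$. The order $2$ quantum transport cost of $e=\{(\omega_\ell,u_\ell,v_\ell)\}_\ell\in Q(\rho,\nu)$ is $$T_2(e)=\sum_\ell\omega_\ell\,\mathrm{Tr}\left[(u_\ell u_\ell^*-v_\ell v_\ell^* )\,\overline{(u_\ell u_\ell^*-v_\ell v_\ell^* )}\right],$$ and the order $2$ quantum Wasserstein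 distance is $W_2(\rho,\nu)=\left(\inf_{e\in Q(\rho,\nu)}T_2(e)\right)^{1/2}$, so that $W_2^2(\rho,\nu)=\inf_{e\in Q(\rho,\nu)}T_2(e)$. *)

(* Defs.v *)
From HB Require Import structures.
From mathcomp Require Import all_boot all_order all_algebra.
From mathcomp Require Import finmap.
From mathcomp Require Import all_classical all_reals all_analysis.
From mathcomp Require Import complex.

Set Implicit Arguments.
Unset Strict Implicit.
Unset Printing Implicit Defensive.

Import Order.TTheory GRing.Theory Num.Theory.
Import numFieldNormedType.Exports.

Local Open Scope classical_set_scope.
Local Open Scope ring_scope.
Local Open Scope sesquilinear_scope.

(* The topology of the modulus on R[i], which the libraries leave undeclared. *)
HB.instance Definition _ (R : realType) := PseudoPointedMetric.copy R[i] R[i]^o.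

Section QuantumTransport.
Variables (R : realType) (n : nat).

Definition qstate (rho : 'M[R[i]]_n) : Prop :=
  [/\ rho \is hermsymmx,
      forall x : 'cV[R[i]]_n, 0 <= (x ^t* *m rho *m x) 0 0
    & \tr rho = 1].

(* The norm `|x| that MathComp-Analysis puts on matrices is the sup norm. *)
Definition l2norm (x : 'cV[R[i]]_n) : R :=
  Num.sqrt (\sum_i Normc.normc (x i 0) ^+ 2).

Definition outer (x : 'cV[R[i]]_n) : 'M[R[i]]_n := x *m x ^t*.

Definition cost (x y : 'cV[R[i]]_n) : R[i] :=
  \tr ((outer x - outer y) *m map_mx Num.conj (outer x - outer y)).

(* \tr (M *m map_mx Num.conj M) equals its own conjugate, so Re loses
   nothing; it can be negative. *)
Definition rcost (x y : 'cV[R[i]]_n) : R := complex.Re (cost x y).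

Definition plan : choiceType := {fset R * 'cV[R[i]]_n * 'cV[R[i]]_n}.

Definition is_plan (rho nu : 'M[R[i]]_n) (e : plan) : Prop :=
  [/\ forall w u v, (w, u, v) \in e ->
        [/\ 0 < w, l2norm u = 1 & l2norm v = 1],
      \sum_(t <- e) t.1.1 = 1,
      \sum_(t <- e) (t.1.1)%:C%C *: outer t.1.2 = rho
    & \sum_(t <- e) (t.1.1)%:C%C *: outer t.2 = nu].

Definition T2 (e : plan) : R := \sum_(t <- e) t.1.1 * rcost t.1.2 t.2.

Definition T2_inf (rho nu : 'M[R[i]]_n) : \bar R :=
  ereal_inf [set (T2 e)%:E | e in [set e | is_plan rho nu e]].

(* The infimum of T2 can be negative (for n = 2, take the pure states of
   (1, 'i) / sqrt 2 and (1, - 'i) / sqrt 2: it is -2), so the square root is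
   the complex one. It is the nonnegative real root when T2_inf >= 0. *)
Definition W2 (rho nu : 'M[R[i]]_n) : R[i] :=
  sqrtC ((fine (T2_inf rho nu))%:C%C).

(* C^n x C^n with the Borel sets of its product topology. *)
Definition borel_pair :=
  g_sigma_algebraType (@open ('cV[R[i]]_n * 'cV[R[i]]_n)%type).

Definition spheres : set borel_pair :=
  [set z | l2norm z.1 = 1 /\ l2norm z.2 = 1].

Definition mxintegral (mu : {measure set borel_pair -> \bar R}) (D : set borel_pair)
    (F : borel_pair -> 'M[R[i]]_n) : 'M[R[i]]_n :=
  \matrix_(i, j) ((\int[mu]_(z in D) complex.Re (F z i j))
               +i* (\int[mu]_(z in D) complex.Im (F z i j)))%C.

(* The set spheres is closed, so mu is supported on it exactly when its
   complement is mu-null. *)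
Definition primal_feasible (rho nu : 'M[R[i]]_n)
    (mu : {finite_measure set borel_pair -> \bar R}) : Prop :=
  [/\ mu (~` spheres) = 0%E,
      mxintegral mu spheres (fun z => outer z.1) = rho
    & mxintegral mu spheres (fun z => outer z.2) = nu].

Definition primal_objective
    (mu : {finite_measure set borel_pair -> \bar R}) : \bar R :=
  (\int[mu]_(z in spheres) (rcost z.1 z.2)%:E)%E.

Definition primal_value (rho nu : 'M[R[i]]_n) : \bar R :=
  ereal_inf [set primal_objective mu | mu in [set mu | primal_feasible rho nu mu]].

(* The order of R[i] is partial: 0 <= z means that z is real and
   nonnegative. *)
Definition dual_feasible (L G : 'M[R[i]]_n) : Prop :=
  [/\ L \is hermsymmx, G \is hermsymmx
    & forall x y : 'cV[R[i]]_n, l2norm x = 1 -> l2norm y = 1 ->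
      0 <= cost x y - (x ^t* *m L *m x) 0 0 - (y ^t* *m G *m y) 0 0].

(* The trace of a product of two Hermitian matrices is real. *)
Definition dual_objective (rho nu L G : 'M[R[i]]_n) : R :=
  complex.Re (\tr (rho *m L + nu *m G)).

Definition dual_value (rho nu : 'M[R[i]]_n) : \bar R :=
  ereal_sup [set (dual_objective rho nu LG.1 LG.2)%:E
            | LG in [set LG | dual_feasible LG.1 LG.2]].

End QuantumTransport.

(* Main.v *)
(* Writing U = x x^* and V = y y^*, a finite measure on the product of spheres
   enters the problem only through the integrals of f and of the entries of U
   and V.  Since \tr U = 1, feasible measures have mass 1, so primal values are
   the heights of the points above (rho, nu) in the convex hull of the compact
   set of all (U, V, f).  By Caratheodory's theorem this hull is already reached
   by combinations of boundedly many points, hence it is compact: the minimum p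
   above (rho, nu) is attained by a finite combination, which is at once a plan
   and a sum of Dirac masses.  The point (rho, nu, p - eps) is outside the hull;
   the hyperplane separating it cannot be vertical, as (rho, nu, p) belongs to
   the hull, and its slope gives (L, G) of dual value p - eps, the constant term
   being absorbed in L as a multiple of the identity.  Weak duality does the
   rest. *)
Require Import Defs.
From HB Require Import structures.
From mathcomp Require Import all_boot all_order all_algebra.
From mathcomp Require Import finmap.
From mathcomp Require Import all_classical all_reals all_analysis.
From mathcomp Require Import measurable_realfun.
From mathcomp Require Import complex.
From mathcomp Require Import ring lra.
Import Order.TTheory GRing.Theory Num.Theory.
Import numFieldNormedType.Exports.
Local Open Scope classical_set_scope.
Local Open Scope ring_scope.
Local Open Scope sesquilinear_scope.

Set Implicit Arguments.
Unset Strict Implicit.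
Unset Printing Implicit Defensive.

(** * Finite-dimensional moment problems *)

Section Barycenter.
Variables (R : realType) (T : Type) (S : set T).

(** Combinations are functions on ['I_N], so that for fixed [N] they form a subset of a product
    space, to which Tychonoff's theorem applies. *)
Definition barycentric N (c : 'I_N -> R * T) : Prop :=
  [/\ forall i, 0 <= (c i).1, forall i, S (c i).2 & \sum_i (c i).1 = 1].

Definition mean N (c : 'I_N -> R * T) (F : T -> R) : R :=
  \sum_i (c i).1 * F (c i).2.

Lemma mean_le N (c : 'I_N -> R * T) (F G : T -> R) :
  barycentric c -> (forall t, S t -> F t <= G t) -> mean c F <= mean c G.
Proof.
by case=> w0 Sc _ FG; apply: ler_sum => i _; rewrite ler_wpM2l ?w0 ?FG.
Qed.

Lemma mean_cst N (c : 'I_N -> R * T) (a : R) :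
  barycentric c -> mean c (fun=> a) = a.
Proof. by case=> _ _ w1; rewrite /mean -mulr_suml w1 mul1r. Qed.

Lemma mean_affine N (c : 'I_N -> R * T) (J : finType) (a : R) (l : J -> R)
    (g : J -> T -> R) : barycentric c ->
  mean c (fun t => a + \sum_j l j * g j t) = a + \sum_j l j * mean c (g j).
Proof.
case=> _ _ w1; rewrite /mean.
under eq_bigr do rewrite mulrDr mulr_sumr.
rewrite big_split /= -mulr_suml w1 mul1r exchange_big /=; congr (_ + _).
by apply: eq_bigr => j _; rewrite mulr_sumr; apply: eq_bigr => i _; rewrite mulrCA.
Qed.

(** The convex hull of the image of [S] under [g], restricted to combinations of [N] points; weights
    may vanish and points may repeat. *)
Definition in_hull (J : finType) (g : J -> T -> R) (b : J -> R) N : Prop :=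
  exists2 c : 'I_N -> R * T, barycentric c & forall j, mean c (g j) = b j.

Variables (J : finType) (g : J -> T -> R) (b : J -> R).

Lemma in_hullS N : in_hull g b N -> in_hull g b N.+1.
Proof.
case=> c [w0 Sc w1] cb.
(* Weights summing to 1 force [N] to be nonzero, so a point of [S] is available to carry the extra
   zero weight. *)
have [i0 _] : exists i : 'I_N, True.
  case: N c w0 Sc w1 cb => [c _ _|N c _ _ _ _]; last by exists ord0.
  by rewrite big_ord0 => /eqP; rewrite eq_sym oner_eq0.
pose c' (i : 'I_N.+1) : R * T :=
  if unlift ord0 i is Some k then c k else (0, (c i0).2).
have c'0 : c' ord0 = (0, (c i0).2) by rewrite /c' unlift_none.
have c'S i : c' (lift ord0 i) = c i by rewrite /c' liftK.
exists c'; first split.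
- by move=> i; rewrite /c'; case: unlift => /=.
- by move=> i; rewrite /c'; case: unlift => /=.
- by rewrite big_ord_recl c'0 add0r -w1; apply: eq_bigr => i _; rewrite c'S.
- move=> j; rewrite -cb /mean big_ord_recl c'0 mul0r add0r.
  by apply: eq_bigr => i _; rewrite c'S.
Qed.

(* The vectors [(1, g t_i)], one more than their dimension, satisfy a linear
   relation; move the weights along it until one of them vanishes. *)
Lemma caratheodory_step N : (#|J| < N)%N -> in_hull g b N.+1 -> in_hull g b N.
Proof.
move=> JN [c [w0 Sc w1] cb].
(* [None] indexes the constant coordinate 1, which makes the relation preserve the total weight. *)
pose A : 'M[R]_(N.+1, #|{: option J}|) := \matrix_(i, k)
  if enum_val k is Some j then g j (c i).2 else 1.
have : kermx A != 0.
  rewrite -mxrank_eq0 mxrank_ker subn_eq0 -ltnNge.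
  by rewrite (leq_ltn_trans (rank_leq_col A))// card_option.
case/rowV0Pn => a /sub_kermxP aA a0.
have rel k : \sum_i a 0 i * (if k is Some j then g j (c i).2 else 1) = 0.
  have := congr1 (fun M : 'rV__ => M 0 (enum_rank k)) aA; rewrite !mxE => aAk.
  by rewrite -[RHS]aAk; apply: eq_bigr => i _; rewrite !mxE enum_rankK.
have a_sum : \sum_i a 0 i = 0.
  by rewrite -[RHS](rel None); apply: eq_bigr => i _; rewrite mulr1.
have [i0 ai0] : exists i, 0 < a 0 i.
  apply/existsP; apply: contraNT a0; rewrite negb_exists => /forallP aN.
  have aN' i : 0 <= - a 0 i by rewrite oppr_ge0 leNgt aN.
  have /psumr_eq0P : \sum_i - a 0 i = 0 by rewrite sumrN a_sum oppr0.
  move=> /(_ (fun i _ => aN' i)) a0.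
  by apply/eqP/rowP => i; rewrite mxE -[LHS]opprK a0 ?oppr0.
(* The smallest ratio is the longest step that keeps all weights nonnegative; the weight at [i1]
   then vanishes. *)
pose i1 := [arg min_(i < i0 | 0 < a 0 i) ((c i).1 / a 0 i)]%O.
have [ai1 i1min] : 0 < a 0 i1 /\
    forall i, 0 < a 0 i -> (c i1).1 / a 0 i1 <= (c i).1 / a 0 i.
  by rewrite /i1; case: arg_minP.
pose r := (c i1).1 / a 0 i1.
pose w i := (c i).1 - r * a 0 i.
have wi1 : w i1 = 0 by rewrite /w /r divfK ?subrr ?gt_eqF.
have w_ge0 i : 0 <= w i.
  rewrite subr_ge0; have [ai|ai] := ltP 0 (a 0 i).
    by rewrite -ler_pdivlMr// i1min.
  by rewrite (le_trans _ (w0 i))// mulr_ge0_le0// divr_ge0 ?w0// ltW.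
have w_sum k : \sum_i w i * (if k is Some j then g j (c i).2 else 1) =
    \sum_i (c i).1 * (if k is Some j then g j (c i).2 else 1).
  rewrite /w; under eq_bigr do rewrite mulrBl -mulrA.
  by rewrite sumrB -mulr_sumr rel mulr0 subr0.
exists (fun i => (w (lift i1 i), (c (lift i1 i)).2)); first split=> //=.
- have := w_sum None; rewrite (bigD1_ord i1)//= wi1 mul0r add0r.
  by under eq_bigr do rewrite mulr1; under [in RHS]eq_bigr do rewrite mulr1; move=> ->.
- move=> j; have := w_sum (Some j); rewrite (bigD1_ord i1)//= wi1 mul0r add0r.
  by rewrite -(cb j) /mean.
Qed.

(** Padding with zero weights or dropping points one by one reaches a number of points independent
    of [N], so one space of combinations describes the whole hull. *)
Lemma caratheodory N : in_hull g b N -> in_hull g b #|J|.+1.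
Proof.
have [NJ|/ltnW JN] := leqP N #|J|.+1.
  by rewrite -(subnK NJ); elim: (_ - _)%N => [|k IH] // /IH; rewrite addSn => /in_hullS.
rewrite -(subnK JN); elim: (_ - _)%N => [|k IH]; first by rewrite add0n.
by rewrite addSn => h; apply/IH/caratheodory_step; rewrite // addnS ltnS leq_addl.
Qed.

End Barycenter.

Lemma continuous_sumr (R : realType) (X : topologicalType) (I : Type)
    (r : seq I) (F : I -> X -> R) :
  (forall i, continuous (F i)) -> continuous (fun x => \sum_(i <- r) F i x).
Proof. by move=> cF; apply: continuous_big => //; exact: add_continuous. Qed.

Lemma continuous_mulr (R : realType) (X : topologicalType) (F G : X -> R) :
  continuous F -> continuous G -> continuous (fun x => F x * G x).
Proof. by move=> cF cG x; apply: cvgM; [exact: cF|exact: cG]. Qed.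

Lemma continuous_addr (R : realType) (X : topologicalType) (F G : X -> R) :
  continuous F -> continuous G -> continuous (fun x => F x + G x).
Proof. by move=> cF cG x; apply: cvgD; [exact: cF|exact: cG]. Qed.

Lemma closed_continuous_eq (R : realType) (X : topologicalType) (F : X -> R) (a : R) :
  continuous F -> closed [set x | F x = a].
Proof.
move=> cF; have -> : [set x | F x = a] = F @^-1` [set a] by [].
by apply: closed_comp => [x _|]; [exact: cF|exact: closed_eq].
Qed.

(** * Compactness of the set of combinations *)

Section BarycenterCompact.
Variables (R : realType) (T : topologicalType) (S : set T) (cS : compact S).
Variable (N : nat).

Local Notation combination := (prod_topology (fun _ : 'I_N => (R * T)%type)).

Lemma continuous_weight i : continuous (fun c : combination => (c i).1).
Proof.
move=> c; apply: (@continuous_comp _ _ _ (fun c : combination => c i) fst).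
  exact: proj_continuous.
exact: cvg_fst.
Qed.

Lemma continuous_mean (F : T -> R) : continuous F ->
  continuous (fun c : combination => mean c F).
Proof.
move=> cF; apply: continuous_sumr => i; apply: continuous_mulr.
  exact: continuous_weight.
move=> c; apply: (@continuous_comp _ _ _ (fun c : combination => c i) (F \o snd)).
  exact: proj_continuous.
by apply: continuous_comp; [exact: cvg_snd|exact: cF].
Qed.

(** Nonnegative weights with sum 1 lie in [0, 1], so this is a closed subset of a product of compact
    sets. *)
Lemma compact_barycentric : compact [set c : combination | barycentric S c].
Proof.
pose box := [set c : combination | forall i, (`[0, 1] `*` S) (c i)].
have cbox : compact box.
  apply: (@tychonoff 'I_N (fun _ => (R * T)%type) (fun _ => `[0, 1] `*` S)) => i.
  by apply: compact_setX => //; exact: segment_compact.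
have -> : [set c : combination | barycentric S c] =
    box `&` [set c : combination | \sum_i (c i).1 = 1].
  apply/seteqP; split=> c /=.
    case=> w0 Sc w1; split=> // i; split=> //=; rewrite in_itv /= w0/= -w1.
    by rewrite (bigD1 i)//= lerDl sumr_ge0.
  by case=> wS w1; split=> // i; have [] := wS i; rewrite /= ?in_itv /= => /andP[].
apply: compact_closedI => //; apply: closed_continuous_eq.
by apply: continuous_sumr => i; exact: continuous_weight.
Qed.

End BarycenterCompact.

Lemma big_option (R : nmodType) (J : finType) (F : option J -> R) :
  \sum_k F k = F None + \sum_j F (Some j).
Proof.
rewrite (bigD1 None)//=; congr (_ + _).
rewrite (reindex_omap Some id) /=; last by case.
by apply: eq_bigl => j; rewrite eqxx.
Qed.

(** * Strict separation of a point from the hull *)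

Section Separation.
Variables (R : realType) (T : topologicalType) (S : set T) (cS : compact S).
Hypothesis S0 : S !=set0.
Variables (J : finType) (g : J -> T -> R) (b : J -> R).
Hypothesis cg : forall j, continuous (g j).

(* [v] points from [b] to the nearest point of the hull. *)
Lemma hull_separation : (forall N, ~ in_hull S g b N) ->
  exists v : J -> R, exists2 d, 0 < d &
    forall t, S t -> d <= \sum_j v j * (g j t - b j).
Proof.
move=> bN; pose N := #|J|.+1.
pose X := prod_topology (fun _ : 'I_N => (R * T)%type).
pose h (c : X) := \sum_j (mean c (g j) - b j) ^+ 2.
have ch : continuous h.
  apply: continuous_sumr => j.
  apply: continuous_mulr; apply: continuous_addr;
    [exact: continuous_mean|exact: cst_continuous|
     exact: continuous_mean|exact: cst_continuous].
have [c] : exists2 c : X, barycentric S c & forall c', barycentric S c' -> h c <= h c'.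
  have [t St] := S0.
  have [||c Kc cmin] := @compact_EVT_min X R h _ _ (@compact_barycentric R T S cS N).
  - exists (fun i => (if i == ord0 then 1 else 0, t)); split=> //= [i|].
      by case: ifP.
    by rewrite -big_mkcond big_pred1_eq.
  - exact: continuous_subspaceT.
  - by exists c; [exact: set_mem|move=> c' Kc'; apply: cmin; exact: mem_set].
move=> Kc cmin; pose v j := mean c (g j) - b j.
have d_gt0 : 0 < h c.
  rewrite lt0r sumr_ge0 ?andbT; last by move=> j _; rewrite sqr_ge0.
  apply/negP => /eqP hc0; apply: (bN N); exists c => // j.
  have /psumr_eq0P : h c = 0 by [].
  move=> /(_ (fun j _ => sqr_ge0 _)) /(_ j isT) /eqP.
  by rewrite sqrf_eq0 subr_eq0 => /eqP.
(* The gap is the squared distance: [v] paired with [g j t - b j] is [h c] plus [v] paired with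
   [e]. *)
exists v, (h c) => // t St.
pose e j := g j t - mean c (g j).
suff ve : 0 <= \sum_j v j * e j.
  rewrite -subr_ge0 (_ : _ - _ = \sum_j v j * e j)// -sumrB.
  by apply: eq_bigr => j _; rewrite /v /e; ring.
(* Moving from [c] towards [t] cannot decrease the distance to [b]. *)
have step r : 0 <= r <= 1 ->
    0 <= r * (2 * (\sum_j v j * e j) + r * (\sum_j e j ^+ 2)).
  move=> /andP[r0 r1].
  (* The point at fraction [r] of the way to [t] is a mean of [N.+1] points; Caratheodory's theorem
     brings it back to [N], where [c] is minimal. *)
  have [c' Kc' c'm] : in_hull S g (fun j => mean c (g j) + r * e j) N.
    apply: (@caratheodory _ _ _ _ _ _ N.+1).
    pose c1 (i : 'I_N.+1) : R * T := if unlift ord0 i is Some k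
      then ((1 - r) * (c k).1, (c k).2) else (r, t).
    have c10 : c1 ord0 = (r, t) by rewrite /c1 unlift_none.
    have c1S i : c1 (lift ord0 i) = ((1 - r) * (c i).1, (c i).2).
      by rewrite /c1 liftK.
    case: (Kc) => w0 Sc w1.
    exists c1; first split.
    - move=> i; rewrite /c1; case: unlift => //= k.
      by rewrite mulr_ge0 ?w0 ?subr_ge0.
    - by move=> i; rewrite /c1; case: unlift.
    - rewrite big_ord_recl c10 /=; under eq_bigr do rewrite c1S /=.
      by rewrite -mulr_sumr w1 mulr1 subrKC.
    - move=> j; rewrite /mean big_ord_recl c10 /=.
      under eq_bigr do rewrite c1S /= -mulrA.
      by rewrite -mulr_sumr -/(mean c (g j)) /e; ring.
  have := cmin _ Kc'; rewrite -subr_ge0 => /le_trans; apply.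
  rewrite -sumrB mulrDr mulrCA !mulr_sumr -big_split/= ler_sum// => j _.
  by rewrite c'm /v le_eqVlt; apply/orP; left; apply/eqP; ring.
rewrite leNgt; apply/negP => ve.
set a := \sum_j v j * e j in ve step.
set D := \sum_j e j ^+ 2 in step.
have D0 : 0 <= D by apply: sumr_ge0 => j _; rewrite sqr_ge0.
have aD : 0 < D - a by lra.
(* For [a < 0] this [r] lies in (0, 1] and satisfies [r * D <= - a], so that
   [2 * a + r * D <= a < 0], against [step]. *)
have r0 : 0 < - a / (D - a) by rewrite divr_gt0// oppr_gt0.
have := step (- a / (D - a)).
rewrite (ltW r0) ler_pdivrMr// mul1r lerDr D0 => /(_ isT).
rewrite pmulr_rge0// mulrAC addrC -lerBlDr sub0r ler_pdivlMr//.
by nra.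
Qed.

End Separation.

(** Compactness gives a lowest combination above [b]; separating the point [eps] below it from the
    hull of the graph of [f] gives an affine minorant of [f] on [S]. *)
Theorem moment_duality (R : realType) (T : topologicalType) (S : set T)
    (J : finType) (g : J -> T -> R) (f : T -> R) (b : J -> R) :
  compact S -> (forall j, continuous (g j)) -> continuous f ->
  (exists N, in_hull S g b N) ->
  exists N, exists c : 'I_N -> R * T,
    [/\ barycentric S c, forall j, mean c (g j) = b j &
      forall eps, 0 < eps -> exists l : J -> R, forall t, S t ->
        mean c f - eps + \sum_j l j * (g j t - b j) <= f t].
Proof.
move=> cS cg cf [N0 [c0 K0 c0b]].
(* [f] is adjoined as the coordinate [None]; [B p] is the point at height [p] above [b]. *)
pose G (k : option J) := if k is Some j then g j else f.
pose B (p : R) (k : option J) := if k is Some j then b j else p.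
have cG k : continuous (G k) by case: k.
pose N := #|{: option J}|.+1; pose X := prod_topology (fun _ : 'I_N => (R * T)%type).
have S0 : S !=set0.
  case: K0 => _; case: N0 c0 {c0b} => [c0 _|N1 c0 Sc _].
    by rewrite big_ord0 => /eqP; rewrite eq_sym oner_eq0.
  by exists (c0 ord0).2.
(* Caratheodory's theorem for [G] also keeps the mean of [f], so a minimum over [N] points is a
   minimum over any number of points. *)
have inN N1 (c1 : 'I_N1 -> R * T) : barycentric S c1 ->
    (forall j, mean c1 (g j) = b j) ->
    exists2 c : X, barycentric S c /\ (forall j, mean c (g j) = b j) &
      mean c f = mean c1 f.
  move=> K1 c1b; have [|c Kc cB] := @caratheodory _ _ S _ G (B (mean c1 f)) N1.
    by exists c1 => // -[j|] //=.
  by exists c; [split=> // j; rewrite (cB (Some j))|rewrite (cB None)].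
pose K := [set c : X | barycentric S c] `&` [set c | forall j, mean c (g j) = b j].
have [|||c /set_mem[Kc cb] cmin] := @compact_EVT_min X R (fun c => mean c f) K.
- by have [c [Kc cb] _] := inN _ _ K0 c0b; exists c.
- apply: compact_closedI; first exact: compact_barycentric.
  have -> : [set c : X | forall j, mean c (g j) = b j] =
      \bigcap_j [set c : X | mean c (g j) = b j].
    by apply/seteqP; split=> c /= h j; [move=> _; exact: h|exact: h].
  apply: closed_bigI => j _; apply: closed_continuous_eq.
  exact: continuous_mean.
- by apply: continuous_subspaceT; exact: continuous_mean.
exists N, c; split=> // eps eps0.
pose p := mean c f.
have [|v [d d0 dv]] := @hull_separation _ _ S cS S0 _ G (B (p - eps)) cG.
  move=> N1 [c1 K1 c1B].
  have [||c2 [K2 c2b] c2f] := inN _ c1; first by [].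
    by move=> j; rewrite (c1B (Some j)).
  have := cmin c2 (mem_set (conj K2 c2b)).
  by rewrite c2f (c1B None) /= -/p; lra.
have dv' t : S t ->
    d <= v None * (f t - (p - eps)) + \sum_j v (Some j) * (g j t - b j).
  by move=> /dv; rewrite big_option.
(* The hyperplane is not vertical: averaged over [c], whose moments are [b], the separation
   inequality becomes [d <= v None * eps]. *)
have v0 : 0 < v None.
  suff : d <= v None * eps by rewrite -(pmulr_lgt0 _ eps0); exact: lt_le_trans.
  pose a := - \sum_k v k * B (p - eps) k.
  have : d <= mean c (fun t => a + \sum_k v k * G k t).
    rewrite -[leLHS](mean_cst d Kc); apply: (mean_le Kc) => t /dv /le_trans; apply.
    by rewrite [leRHS]addrC -sumrB ler_sum// => k _; rewrite mulrBr.
  move=> /le_trans; apply; rewrite (mean_affine _ _ _ Kc) [leLHS]addrC -sumrB big_option /=.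
  rewrite big1 ?addr0 => [|j _]; last by rewrite cb subrr.
  by rewrite -mulrBr -/p opprB addrC subrK.
(* Dividing by [v None] isolates [f t]; the positive remainder [d / v None] is dropped. *)
exists (fun j => - v (Some j) / v None) => t /dv' h.
under eq_bigr do rewrite mulrAC.
rewrite -mulr_suml -(ler_pM2l v0) mulrDr mulrCA divff ?gt_eqF// mulr1.
under eq_bigr do rewrite mulNr.
by rewrite sumrN -/p; nra.
Qed.

(** * Hermitian matrices in real coordinates *)

Section ComplexParts.
Variable R : realType.
Implicit Types (z : R[i]) (r : bool).

(** A boolean index for the two real coordinates lets all moments form one finite family. *)
Definition part r z : R := if r then complex.Re z else complex.Im z.

Lemma part_inj z z' : (forall r, part r z = part r z') -> z = z'.
Proof.
case: z z' => [a b] [a' b'] e.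
by have /= -> := e true; have /= -> := e false.
Qed.

Lemma partD r z z' : part r (z + z') = part r z + part r z'.
Proof. by case: r z z' => -[a b] [a' b']. Qed.

Lemma partB r z z' : part r (z - z') = part r z - part r z'.
Proof. by case: r z z' => -[a b] [a' b']. Qed.

Lemma part0 r : part r 0 = 0. Proof. by case: r. Qed.

Lemma part_sum r (I : Type) (s : seq I) (P : pred I) (F : I -> R[i]) :
  part r (\sum_(i <- s | P i) F i) = \sum_(i <- s | P i) part r (F i).
Proof. by apply: (big_morph (part r) (partD r)); rewrite part0. Qed.

Lemma part_realM r (a : R) z : part r (a%:C%C * z) = a * part r z.
Proof. by case: r z => -[b c] /=; rewrite mul0r ?subr0 ?addr0. Qed.

Lemma ReM z z' : complex.Re (z * z') =
  complex.Re z * complex.Re z' - complex.Im z * complex.Im z'.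
Proof. by case: z z' => [a b] [a' b']. Qed.

Lemma ImM z z' : complex.Im (z * z') =
  complex.Re z * complex.Im z' + complex.Im z * complex.Re z'.
Proof. by case: z z' => [a b] [a' b']. Qed.

Lemma ReJ z : complex.Re (Num.conj z) = complex.Re z.
Proof. by case: z. Qed.

Lemma ImJ z : complex.Im (Num.conj z) = - complex.Im z.
Proof. by case: z. Qed.

Lemma sqr_normcE z : Normc.normc z ^+ 2 = complex.Re z ^+ 2 + complex.Im z ^+ 2.
Proof. by case: z => a b /=; rewrite sqr_sqrtr ?addr_ge0 ?sqr_ge0. Qed.

End ComplexParts.

Section RealTrace.
Variables (R : realType) (n : nat).
Local Notation C := R[i].

Lemma hermsymmxP (A : 'M[C]_n) :
  reflect (forall i j, A j i = Num.conj (A i j)) (A \is hermsymmx).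
Proof.
apply: (iffP (is_hermitianmxP _ _ _)) => [/matrixP h i j|h].
  by rewrite h expr0 scale1r !mxE.
by apply/matrixP => i j; rewrite expr0 scale1r !mxE h.
Qed.

Lemma hermsymmx_outer (x : 'cV[C]_n) : outer x \is hermsymmx.
Proof.
apply/hermsymmxP => i j.
rewrite /outer !mxE !big_ord1 !mxE rmorphM/= mulrC; congr (_ * _).
by rewrite conjCK.
Qed.

Lemma hermsymmxD (A B : 'M[C]_n) :
  A \is hermsymmx -> B \is hermsymmx -> A + B \is hermsymmx.
Proof.
move=> /hermsymmxP hA /hermsymmxP hB; apply/hermsymmxP => i j.
by rewrite !mxE hA hB rmorphD.
Qed.

Lemma hermsymmx_real_scalar (a : R) : ((a%:C%C)%:M : 'M[C]_n) \is hermsymmx.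
Proof.
apply/hermsymmxP => i j; rewrite !mxE eq_sym; case: eqP => _ /=.
  by rewrite /= !mulr1n; apply: (@part_inj R) => -[]; rewrite /= ?ReJ ?ImJ /= ?oppr0.
by rewrite !mulr0n rmorph0.
Qed.

Definition rtr (A B : 'M[C]_n) : R := complex.Re (\tr (A *m B)).

Lemma rtrE (A B : 'M[C]_n) : rtr A B = \sum_i \sum_j
  (complex.Re (A i j) * complex.Re (B j i) - complex.Im (A i j) * complex.Im (B j i)).
Proof.
rewrite /rtr -[LHS]/(part true _) /mxtrace part_sum; apply: eq_bigr => i _.
by rewrite mxE part_sum; apply: eq_bigr => j _; rewrite /= ReM.
Qed.

(** Conjugation turns [A i j * B j i] into [A j i * B i j], which only swaps the summation indices,
    so the imaginary part vanishes. *)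
Lemma tr_hermsymmx (A B : 'M[C]_n) : A \is hermsymmx -> B \is hermsymmx ->
  \tr (A *m B) = (rtr A B)%:C%C.
Proof.
move=> /hermsymmxP hA /hermsymmxP hB; apply: (@part_inj R) => -[] //=.
have : \tr (A *m B) = Num.conj (\tr (A *m B)).
  rewrite /mxtrace rmorph_sum /=; under eq_bigr do rewrite mxE.
  under [in RHS]eq_bigr do rewrite mxE rmorph_sum /=.
  rewrite exchange_big /=; apply: eq_bigr => i _; apply: eq_bigr => j _.
  by rewrite rmorphM/= -hA -hB.
by move=> /(congr1 (@complex.Im R)); rewrite ImJ; lra.
Qed.

Lemma quad_outer (x : 'cV[C]_n) (L : 'M[C]_n) :
  (x ^t* *m L *m x) 0 0 = \tr (outer x *m L).
Proof.
by rewrite /outer -[in RHS]mulmxA mxtrace_mulC trace_mx11.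
Qed.

Lemma outerE (x : 'cV[C]_n) i j : outer x i j = x i 0 * Num.conj (x j 0).
Proof. by rewrite /outer !mxE big_ord1 !mxE. Qed.

Lemma Re_outer (x : 'cV[C]_n) i j : complex.Re (outer x i j) =
  complex.Re (x i 0) * complex.Re (x j 0) + complex.Im (x i 0) * complex.Im (x j 0).
Proof. by rewrite outerE ReM ReJ ImJ mulrN opprK. Qed.

Lemma Im_outer (x : 'cV[C]_n) i j : complex.Im (outer x i j) =
  complex.Im (x i 0) * complex.Re (x j 0) - complex.Re (x i 0) * complex.Im (x j 0).
Proof. by rewrite outerE ImM ReJ ImJ mulrN addrC. Qed.

Lemma l2norm_eq1 (x : 'cV[C]_n) : l2norm x = 1 <->
  \sum_i (complex.Re (x i 0) ^+ 2 + complex.Im (x i 0) ^+ 2) = 1.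
Proof.
rewrite /l2norm; under eq_bigr do rewrite sqr_normcE.
split=> [/(congr1 (fun a => a ^+ 2))|->]; last by rewrite sqrtr1.
by rewrite expr1n sqr_sqrtr// sumr_ge0// => i _; rewrite addr_ge0 ?sqr_ge0.
Qed.

Lemma tr_outer (x : 'cV[C]_n) : l2norm x = 1 -> \tr (outer x) = 1.
Proof.
move=> /l2norm_eq1 x1; apply: (@part_inj R) => r; rewrite /mxtrace part_sum.
case: r => /=.
  by rewrite -x1; apply: eq_bigr => i _; rewrite Re_outer !expr2.
by rewrite big1// => i _; rewrite Im_outer mulrC subrr.
Qed.

Lemma l2norm_tr_outer (x : 'cV[C]_n) : \tr (outer x) = 1 -> l2norm x = 1.
Proof.
move=> /(congr1 (part true)); rewrite /mxtrace part_sum /= => x1.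
by apply/l2norm_eq1; rewrite -x1; apply: eq_bigr => i _; rewrite Re_outer !expr2.
Qed.

Lemma hermsymmxB (A B : 'M[C]_n) :
  A \is hermsymmx -> B \is hermsymmx -> A - B \is hermsymmx.
Proof.
move=> /hermsymmxP hA /hermsymmxP hB; apply/hermsymmxP => i j.
by rewrite !mxE hA hB rmorphB.
Qed.

Lemma hermsymmxJ (A : 'M[C]_n) :
  A \is hermsymmx -> map_mx Num.conj A \is hermsymmx.
Proof. by move=> /hermsymmxP hA; apply/hermsymmxP => i j; rewrite !mxE hA. Qed.

Lemma costE (x y : 'cV[C]_n) : cost x y = (rcost x y)%:C%C.
Proof.
have h := hermsymmxB (hermsymmx_outer x) (hermsymmx_outer y).
exact: (tr_hermsymmx h (hermsymmxJ h)).
Qed.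

Lemma rcostE (x y : 'cV[C]_n) : rcost x y = \sum_i \sum_j
  ((complex.Re (outer x i j) - complex.Re (outer y i j)) *
   (complex.Re (outer x j i) - complex.Re (outer y j i)) +
   (complex.Im (outer x i j) - complex.Im (outer y i j)) *
   (complex.Im (outer x j i) - complex.Im (outer y j i))).
Proof.
rewrite /rcost /cost -/(rtr _ _) rtrE; apply: eq_bigr => i _; apply: eq_bigr => j _.
have E (k l : 'I_n) : (outer x - outer y) k l = outer x k l - outer y k l.
  by rewrite !mxE.
rewrite [map_mx _ _ _ _]mxE ReJ ImJ !E mulrN opprK.
by rewrite -![complex.Re (_ - _)]/(part true _) -![complex.Im (_ - _)]/(part false _) !partB.
Qed.

(** Represents the real functional with coefficients [l] through [rtr]; the transposed indices and
    the minus sign undo those in [rtrE]. *)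
Definition rep_mx (l : bool -> 'I_n -> 'I_n -> R) : 'M[C]_n :=
  \matrix_(i, j) (l true j i -i* l false j i)%C.

Definition herm_part (M : 'M[C]_n) : 'M[C]_n := 2^-1 *: (M + M ^t*).

Lemma hermsymmx_herm_part M : herm_part M \is hermsymmx.
Proof.
apply/hermsymmxP => i j; rewrite !mxE rmorphM fmorphV rmorph_nat rmorphD/= conjCK.
by rewrite addrC.
Qed.

(** For Hermitian [A], the traces of [A *m M] and [A *m M ^t*] are conjugate, so a representing
    matrix can be made Hermitian without changing its values on Hermitian matrices. *)
Lemma rtr_herm_part (A M : 'M[C]_n) : A \is hermsymmx -> rtr A (herm_part M) = rtr A M.
Proof.
move=> /hermsymmxP hA; rewrite /rtr -scalemxAr mulmxDr linearZ /= raddfD /=.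
have -> : \tr (A *m M ^t*) = Num.conj (\tr (A *m M)).
  rewrite [\tr (A *m M)]mxtrace_mulC /mxtrace rmorph_sum /=; apply: eq_bigr => i _.
  rewrite !mxE rmorph_sum /=; apply: eq_bigr => j _.
  by rewrite !mxE rmorphM/= -hA mulrC.
have -> : (2^-1 : C) = (2^-1 : R)%:C%C by rewrite fmorphV rmorph_nat.
by rewrite -[LHS]/(part true _) part_realM partD /= ReJ; lra.
Qed.

Lemma rtr_rep_mx (A : 'M[C]_n) l :
  rtr A (rep_mx l) = \sum_i \sum_j \sum_r l r i j * part r (A i j).
Proof.
rewrite rtrE; apply: eq_bigr => i _; apply: eq_bigr => j _.
by rewrite !mxE /= big_bool /=; ring.
Qed.

Lemma rtrDr (A B D : 'M[C]_n) : rtr A (B + D) = rtr A B + rtr A D.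
Proof. by rewrite /rtr mulmxDr raddfD /= -[LHS]/(part true _) partD. Qed.

Lemma rtr_scalar (A : 'M[C]_n) (a : R) :
  \tr A = 1 -> rtr A (a%:C%C)%:M = a.
Proof. by move=> A1; rewrite /rtr mul_mx_scalar linearZ /= A1 mulr1. Qed.

End RealTrace.

(** * Topology of the product of spheres *)

Lemma continuous_part (R : realType) r : continuous (@part R r : R[i] -> R).
Proof.
move=> z U /nbhs_ballP [e e0 eU]; exists (e%:C)%C; first by rewrite /= ltcR.
move=> y; rewrite /ball_ /= normc_def ltcR => zy; apply: eU.
rewrite /ball /= -partB -sqrtr_sqr; apply: le_lt_trans zy.
by rewrite ler_wsqrtr//; case: r; rewrite /= ?lerDl ?lerDr sqr_ge0.
Qed.

Section Regular.
Variables (R : realType) (n : nat).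
Local Notation C := R[i].
Local Notation V := ('cV[C]_n * 'cV[C]_n)%type.

(** The index [true] stands for x and [rho], [false] for y and [nu], throughout. *)
Definition side (s : bool) (z : V) : 'cV[C]_n := if s then z.1 else z.2.

Definition rcoord (k : bool * bool * 'I_n) (z : V) : R :=
  part k.1.2 (side k.1.1 z k.2 0).

Lemma continuous_rcoord k : continuous (rcoord k : V -> R).
Proof.
case: k => -[s r] i z; rewrite /rcoord /=.
have cs : {for z, continuous (fun z : V => side s z : 'cV[C]_n)}.
  by case: s; rewrite /side; [exact: cvg_fst|exact: cvg_snd].
have cc : {for side s z, continuous (fun x : 'cV[C]_n => x i 0 : C)}.
  exact: (@coord_continuous C).
exact: (continuous_comp (continuous_comp cs cc) (@continuous_part R r _)).
Qed.

(* Quantifying over [G] serves two topologies at once: the Borel structure of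
   the statement ([G] the identity) and a compact set of real parameters. *)
Definition regular (F : V -> R) : Prop := forall (X : topologicalType) (G : X -> V),
  (forall k, continuous (rcoord k \o G)) -> continuous (F \o G).

Lemma regular_rcoord k : regular (rcoord k).
Proof. by move=> X G; exact. Qed.

Lemma regular_cst a : regular (cst a).
Proof. by move=> X G _; exact: cst_continuous. Qed.

Lemma regularD F G : regular F -> regular G -> regular (fun z => F z + G z).
Proof. by move=> rF rG X H cH; apply: continuous_addr; [exact: rF|exact: rG]. Qed.

Lemma regularM F G : regular F -> regular G -> regular (fun z => F z * G z).
Proof. by move=> rF rG X H cH; apply: continuous_mulr; [exact: rF|exact: rG]. Qed.

Lemma regularB F G : regular F -> regular G -> regular (fun z => F z - G z).
Proof.
move=> rF rG; have -> : (fun z => F z - G z) = (fun z => F z + -1 * G z).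
  by apply/funext => z; rewrite mulN1r.
by apply: regularD => //; apply: regularM => //; exact: regular_cst.
Qed.

Lemma regular_sum (I : Type) (s : seq I) (F : I -> V -> R) :
  (forall i, regular (F i)) -> regular (fun z => \sum_(i <- s) F i z).
Proof. by move=> rF X H cH; apply: continuous_sumr => i; exact: rF. Qed.

Definition entry (k : bool * bool * 'I_n * 'I_n) (z : V) : R :=
  part k.1.1.2 (outer (side k.1.1.1 z) k.1.2 k.2).

Lemma regular_entry k : regular (entry k).
Proof.
case: k => -[[s r] i] j.
have rc r' i' : regular (rcoord (s, r', i')) by exact: regular_rcoord.
have -> : entry (s, r, i, j) = fun z => if r
    then rcoord (s, true, i) z * rcoord (s, true, j) z +
         rcoord (s, false, i) z * rcoord (s, false, j) z
    else rcoord (s, false, i) z * rcoord (s, true, j) z -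
         rcoord (s, true, i) z * rcoord (s, false, j) z.
  by apply/funext => z; rewrite /entry /part /=; case: r; rewrite ?Re_outer ?Im_outer.
by case: r; [apply: regularD|apply: regularB]; apply: regularM.
Qed.

Lemma regular_rcost : regular (fun z => rcost z.1 z.2).
Proof.
have -> : (fun z : V => rcost z.1 z.2) = fun z => \sum_i \sum_j
    ((entry (true, true, i, j) z - entry (false, true, i, j) z) *
     (entry (true, true, j, i) z - entry (false, true, j, i) z) +
     (entry (true, false, i, j) z - entry (false, false, i, j) z) *
     (entry (true, false, j, i) z - entry (false, false, j, i) z)).
  by apply/funext => z; rewrite rcostE.
apply: regular_sum => i; apply: regular_sum => j.
by apply: regularD; apply: regularM; apply: regularB; exact: regular_entry.
Qed.

Lemma regular_rtr s (L : 'M[C]_n) : regular (fun z => rtr (outer (side s z)) L).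
Proof.
have -> : (fun z => rtr (outer (side s z)) L) = fun z => \sum_i \sum_j
    (entry (s, true, i, j) z * complex.Re (L j i) -
     entry (s, false, i, j) z * complex.Im (L j i)).
  by apply/funext => z; rewrite rtrE.
apply: regular_sum => i; apply: regular_sum => j.
by apply: regularB; apply: regularM; (exact: regular_entry || exact: regular_cst).
Qed.

Definition sqnorm s (z : V) : R :=
  \sum_i (rcoord (s, true, i) z * rcoord (s, true, i) z +
          rcoord (s, false, i) z * rcoord (s, false, i) z).

Lemma regular_sqnorm s : regular (sqnorm s).
Proof.
by apply: regular_sum => i; apply: regularD; apply: regularM; exact: regular_rcoord.
Qed.

(** Squared norms are polynomial in the real coordinates, which yields both closedness and
    measurability. *)
Lemma spheresE : @spheres R n = [set z | sqnorm true z = 1] `&` [set z | sqnorm false z = 1].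
Proof.
have sq s z : sqnorm s z = 1 <-> l2norm (side s z) = 1.
  rewrite (rwP eqP) (rwP eqP); split=> /eqP.
    by move=> z1; apply/eqP/l2norm_eq1; rewrite -z1; apply: eq_bigr => i _; rewrite !expr2.
  by move=> /l2norm_eq1 z1; apply/eqP; rewrite -z1; apply: eq_bigr => i _; rewrite !expr2.
by apply/seteqP; split=> z [z1 z2]; split; [exact/(sq true)|exact/(sq false)|exact/(sq true)|exact/(sq false)].
Qed.

(* Real coordinates turn the product of spheres into a closed subset of a cube,
   compact by Tychonoff's theorem. *)
Local Notation params := (prod_topology (fun _ : bool * bool * 'I_n => R : topologicalType)).

Definition of_params (t : params) : V :=
  (\col_i (t (true, true, i) +i* t (true, false, i))%C,
   \col_i (t (false, true, i) +i* t (false, false, i))%C).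

Lemma rcoord_of_params k t : rcoord k (of_params t) = t k.
Proof. by case: k => -[[] []] i; rewrite /rcoord /= mxE. Qed.

Definition to_params (z : V) : params := fun k => rcoord k z.

Lemma to_paramsK : cancel to_params of_params.
Proof.
case=> x y; congr (_, _); apply/colP => i; rewrite mxE /to_params /rcoord /=.
  by case: (x i 0).
by case: (y i 0).
Qed.

Lemma regular_of_params F : regular F -> continuous (F \o of_params).
Proof.
apply => k; have -> : rcoord k \o of_params = (fun t => t k).
  by apply/funext => t; rewrite /= rcoord_of_params.
exact: proj_continuous.
Qed.

Lemma compact_spheres_params : compact (of_params @^-1` @spheres R n).
Proof.
pose box := [set t : params | forall k, `[-1, 1]%classic (t k)].
have cbox : compact box.
  by apply: (@tychonoff _ (fun=> R : topologicalType) (fun _ => `[-1, 1]%classic)) => k; exact: segment_compact.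
have -> : of_params @^-1` @spheres R n = box `&`
    ([set t | (sqnorm true \o of_params) t = 1] `&`
     [set t | (sqnorm false \o of_params) t = 1]).
  rewrite spheresE; apply/seteqP; split=> [t [t1 t2]|t [_ []]] //; split=> //.
  (* A single squared coordinate is at most the whole sum, which is 1. *)
  case=> -[s r] i; rewrite /= in_itv /= -ler_norml -(@expr_le1 _ 2)//.
  rewrite real_normK ?num_real//.
  have ts : sqnorm s (of_params t) = 1 by case: s.
  rewrite -ts /sqnorm (bigD1 i)//= !rcoord_of_params -!expr2 ler_wpDr//.
    by rewrite sumr_ge0// => k _; rewrite addr_ge0 ?sqr_ge0.
  by case: r; rewrite ?lerDl ?lerDr sqr_ge0.
apply: compact_closedI => //.
by apply: closedI; apply: closed_continuous_eq; exact/regular_of_params/regular_sqnorm.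
Qed.

(** The compact parameter set has bounded image, and by [to_paramsK] every point of the spheres has
    parameters in it. *)
Lemma regular_bounded F : regular F ->
  exists M, forall z, @spheres R n z -> `|F z| <= M.
Proof.
move=> /regular_of_params cF.
have : compact ((F \o of_params) @` (of_params @^-1` @spheres R n)).
  apply: continuous_compact; last exact: compact_spheres_params.
  exact: continuous_subspaceT.
move=> /compact_bounded[M [_ /(_ (M + 1))]]; rewrite ltrDl ltr01 => /(_ isT) FM.
exists (M + 1) => z Sz; apply: FM; exists (to_params z); rewrite /= ?to_paramsK//.
Qed.

Lemma regular_continuous F : regular F -> continuous F.
Proof. by move=> /(_ _ id); apply => k; exact: continuous_rcoord. Qed.

Lemma regular_measurable F (D : set (borel_pair R n)) :
  regular F -> measurable_fun D (F : borel_pair R n -> R).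
Proof.
move=> /regular_continuous /continuousP cF; apply: (@measurable_funS _ _ _ _ setT) => //.
apply: (measurability _ (RGenOpens.measurableE R)).
move=> _ [_ [a [b ->] <-]]; rewrite setTI; apply: sub_sigma_algebra.
exact/cF/interval_open.
Qed.

Lemma measurable_spheres : measurable (@spheres R n).
Proof.
rewrite spheresE; apply: measurableI.
  have := regular_measurable (D := setT) (@regular_sqnorm true).
  by move=> /(_ measurableT [set 1] (measurable_set1 _)); rewrite setTI.
have := regular_measurable (D := setT) (@regular_sqnorm false).
by move=> /(_ measurableT [set 1] (measurable_set1 _)); rewrite setTI.
Qed.

Lemma regular_integrable (mu : {finite_measure set (borel_pair R n) -> \bar R}) F :
  regular F -> mu.-integrable (@spheres R n) (EFin \o F).
Proof.
move=> rF; apply: measurable_bounded_integrable.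
- exact: measurable_spheres.
- by rewrite ltey_eq fin_num_measure//; exact: measurable_spheres.
- exact: regular_measurable.
- have [M FM] := regular_bounded rF; exists M; split; first exact: num_real.
  by move=> x Mx z Sz; apply: le_trans (FM z Sz) (ltW Mx).
Qed.

End Regular.
Arguments of_params {R n} t.

(** * Measures *)

Section Measures.
Variables (R : realType) (n : nat).
Local Notation C := R[i].
Local Notation V := ('cV[C]_n * 'cV[C]_n)%type.
Local Notation S := (@spheres R n).
Local Notation B := (borel_pair R n).

(** * Weak duality for measures *)

Section WeakDuality.
Variable mu : {finite_measure set B -> \bar R}.

Let mS := @measurable_spheres R n.
Let intS F (rF : regular F) := regular_integrable mu rF.

Lemma Rintegral_sum (I : Type) (s : seq I) (F : I -> V -> R) :
  (forall i, regular (F i)) ->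
  \int[mu]_(z in S) (\sum_(i <- s) F i z) = \sum_(i <- s) \int[mu]_(z in S) F i z.
Proof.
move=> rF; elim: s => [|i s IH].
  rewrite big_nil; under eq_Rintegral do rewrite big_nil.
  by rewrite Rintegral_cst// mul0r.
rewrite big_cons -IH -RintegralD//.
- by apply: eq_Rintegral => z _; rewrite big_cons.
- exact: intS.
- by apply: intS; exact: regular_sum.
Qed.

(** [rtr] is a real linear combination of the parts of the entries, which [mxintegral] integrates
    one by one. *)
Lemma Rintegral_rtr s (L : 'M[C]_n) :
  \int[mu]_(z in S) rtr (outer (side s z)) L =
  rtr (mxintegral mu S (fun z => outer (side s z))) L.
Proof.
have rE r i j : regular (entry (s, r, i, j) : V -> R) by exact: regular_entry.
have rM r i j a : regular (fun z : V => entry (s, r, i, j) z * a).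
  by apply: regularM; [exact: rE|exact: regular_cst].
rewrite rtrE; under eq_Rintegral do rewrite rtrE.
rewrite (@Rintegral_sum _ _ (fun i (z : V) => \sum_j
    (entry (s, true, i, j) z * complex.Re (L j i) -
     entry (s, false, i, j) z * complex.Im (L j i)))); last first.
  by move=> i; apply: regular_sum => j; apply: regularB.
apply: eq_bigr => i _; rewrite Rintegral_sum; last by move=> j; apply: regularB.
apply: eq_bigr => j _; rewrite mxE /=.
rewrite RintegralB//; [|exact: intS|exact: intS].
by congr (_ - _); rewrite RintegralZr//; exact: intS.
Qed.

Lemma primal_objectiveE : primal_objective mu =
  (\int[mu]_(z in S) rcost z.1 z.2)%:E.
Proof.
rewrite /primal_objective /Rintegral fineK//; apply: integrable_fin_num => //.
exact/intS/regular_rcost.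
Qed.

(** Integrating the dual constraint turns the two quadratic terms into traces against the moments
    [rho] and [nu]. *)
Lemma weak_duality (rho nu L G : 'M[C]_n) :
  primal_feasible rho nu mu -> dual_feasible L G ->
  ((dual_objective rho nu L G)%:E <= primal_objective mu)%E.
Proof.
move=> [_ muL muG] [hL hG LG]; rewrite primal_objectiveE lee_fin.
rewrite /dual_objective raddfD /= -[leLHS]/(part true _) partD /=.
have -> : complex.Re (\tr (rho *m L)) = \int[mu]_(z in S) rtr (outer (side true z)) L.
  by rewrite Rintegral_rtr; congr rtr.
have -> : complex.Re (\tr (nu *m G)) = \int[mu]_(z in S) rtr (outer (side false z)) G.
  by rewrite Rintegral_rtr; congr rtr.
rewrite -RintegralD//; [|exact/intS/regular_rtr|exact/intS/regular_rtr].
apply: le_Rintegral => //.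
- by apply/intS/regularD; exact: regular_rtr.
- exact/intS/regular_rcost.
move=> [x y] [/= x1 y1]; have := LG _ _ x1 y1.
rewrite costE !quad_outer !tr_hermsymmx ?hermsymmx_outer// -!rmorphB ler0c.
by rewrite -addrA -opprD subr_ge0.
Qed.

End WeakDuality.

(** * Finitely supported measures *)

Section Discrete.
Variables (N : nat) (w : nat -> {nonneg R}) (p : nat -> B).

Definition discrete_measure : set B -> \bar R :=
  msum (fun k => mscale (w k) \d_(p k)) N.

HB.instance Definition _ := Measure.on discrete_measure.

Let discrete_measure_fin : fin_num_fun discrete_measure.
Proof.
move=> U mU; rewrite /discrete_measure /msum; apply/sum_fin_numP => i _ _.
by rewrite /mscale/= fin_numM// fin_num_measure.
Qed.

HB.instance Definition _ := @Measure_isFinite.Build _ _ _ discrete_measure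
  discrete_measure_fin.

Hypothesis Sp : forall k, S (p k).

Lemma integral_discrete F : regular F ->
  \int[discrete_measure]_(z in S) F z = \sum_(k < N) (w k)%:num * F (p k).
Proof.
have mS := @measurable_spheres R n.
have pos G : regular G -> (forall z, S z -> 0 <= G z) ->
    \int[discrete_measure]_(z in S) G z = \sum_(k < N) (w k)%:num * G (p k).
  move=> rG G0; have mG := regular_measurable (D := S) rG.
  rewrite /Rintegral ge0_integral_measure_sum//; last exact/measurable_EFinP.
  rewrite (eq_bigr (fun k : 'I_N => ((w k)%:num * G (p k))%:E)) ?sumEFin// => k _.
  rewrite ge0_integral_mscale//; last exact/measurable_EFinP.
  rewrite integral_dirac//; last exact/measurable_EFinP.
  by rewrite diracE mem_set ?mul1e.
(* Adding a bound [M] reduces a signed [F] to the nonnegative case. *)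
move=> rF; have [M FM] := regular_bounded rF.
have rM : regular (cst M : V -> R) by exact: regular_cst.
have M0 z : S z -> 0 <= M by move=> /FM; exact: le_trans.
have -> : \int[discrete_measure]_(z in S) F z =
    \int[discrete_measure]_(z in S) ((F z + M) - M).
  by apply: eq_Rintegral => z _; rewrite addrK.
rewrite RintegralB//; last 2 first.
- by apply: regular_integrable; exact: regularD.
- exact: regular_integrable.
rewrite !pos//; last 2 first.
- exact: regularD.
- by move=> z /FM; rewrite ler_norml => /andP[? _]; lra.
by rewrite -sumrB; apply: eq_bigr => k _; ring.
Qed.

Lemma discrete_measureC : discrete_measure (~` S) = 0%E.
Proof.
rewrite /discrete_measure /msum big1// => k _.
by rewrite /= /mscale /= /dirac indicE memNset ?mule0//; apply.
Qed.

End Discrete.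
End Measures.

(** * States, plans and dual certificates *)

Lemma in_hull_fin (R : realType) (T : Type) (S : set T) (J K : finType)
    (g : J -> T -> R) (b : J -> R) (w : K -> R) (s : K -> T) :
  (forall k, 0 <= w k) -> (forall k, S (s k)) -> \sum_k w k = 1 ->
  (forall j, \sum_k w k * g j (s k) = b j) -> in_hull S g b #|K|.
Proof.
move=> w0 Ss w1 wb.
have reidx (F : K -> R) : \sum_(i < #|K|) F (enum_val i) = \sum_k F k.
  by rewrite [RHS]big_enum_val.
exists (fun i => (w (enum_val i), s (enum_val i))); first split=> //=.
  by rewrite (reidx w).
by move=> j; rewrite /mean /= (reidx (fun k => w k * g j (s k))).
Qed.

(** * Spectral decomposition of states *)

Section Decomposition.
Variables (R : realType) (n : nat).
Local Notation C := R[i].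

(** By the spectral theorem: the eigenvalues serve as weights, nonnegative by positivity and of sum
    1 by the trace, with unit eigenvectors. *)
Lemma qstate_decomposition (rho : 'M[C]_n) : qstate rho ->
  exists w : 'I_n -> R, exists u : 'I_n -> 'cV[C]_n,
    [/\ forall i, 0 <= w i, forall i, l2norm (u i) = 1, \sum_i w i = 1
      & rho = \sum_i (w i)%:C%C *: outer (u i)].
Proof.
case=> rho_herm rho_pos rho_tr.
pose P := spectralmx rho; pose D := spectral_diag rho.
have Pu : P \is unitarymx by exact: spectral_unitarymx.
have PP : P *m P ^t* = 1%:M by apply/unitarymxP.
have rhoE : rho = P ^t* *m diag_mx D *m P.
  by rewrite -invmx_unitary//; apply/orthomx_spectralP/hermitian_normalmx.
pose u i := (row i P) ^t*.
have uJ i : (u i) ^t* = row i P by rewrite /u trmxCK.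
have rowP1 i : (row i P *m (row i P) ^t*) 0 0 = 1.
  have /matrixP/(_ i i) := PP; rewrite [in RHS]mxE eqxx mulr1n => <-.
  by rewrite !mxE; apply: eq_bigr => k _; rewrite !mxE.
(* The eigenvalue is the quadratic form of [rho] at its eigenvector [u i]. *)
have Dpos i : 0 <= D 0 i.
  have := rho_pos (u i); rewrite uJ rhoE !mulmxA.
  have -> : row i P *m P ^t* = delta_mx 0 i by rewrite -row_mul PP rowE mulmx1.
  have -> : delta_mx 0 i *m diag_mx D *m P *m u i = (D 0 i)%:M.
    rewrite -rowE row_diag_mx -!scalemxAl -rowE /u.
    have -> : row i P *m (row i P) ^t* = 1%:M.
      by apply/matrixP => a b; rewrite !ord1 rowP1 mxE eqxx.
    by rewrite scalemx1.
  by rewrite mxE.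
have DE i : D 0 i = (complex.Re (D 0 i))%:C%C by rewrite RRe_real// ger0_real.
have u1 i : l2norm (u i) = 1.
  by apply: l2norm_tr_outer; rewrite /outer uJ mxtrace_mulC trace_mx11.
have rhoS : rho = \sum_i (complex.Re (D 0 i))%:C%C *: outer (u i).
  rewrite {1}rhoE; apply/matrixP => a b; rewrite summxE mxE.
  apply: eq_bigr => i _; rewrite mul_mx_diag !mxE -DE.
  rewrite big_ord1 !mxE conjCK.
  by rewrite mulrA [_ * D _ _]mulrC.
exists (fun i => complex.Re (D 0 i)), u; split=> //.
  by move=> i; rewrite -ler0c -DE.
apply: complexI; rewrite rmorph_sum rmorph1 -rho_tr [in RHS]rhoS raddf_sum /=.
by apply: eq_bigr => i _; rewrite linearZ /= tr_outer// mulr1.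
Qed.

Lemma sum_scale_eq (I : Type) (r : seq I) (w : I -> R) (A : I -> 'M[C]_n) (M : 'M[C]_n) :
  (forall q i j, \sum_(t <- r) w t * part q (A t i j) = part q (M i j)) ->
  \sum_(t <- r) (w t)%:C%C *: A t = M.
Proof.
move=> wA; apply/matrixP => i j; apply: (@part_inj R) => q.
rewrite summxE part_sum -wA; apply: eq_bigr => t _.
by rewrite mxE part_realM.
Qed.

Lemma rtr_sum (I : Type) (r : seq I) (w : I -> R) (A : I -> 'M[C]_n) (L : 'M[C]_n) :
  rtr (\sum_(t <- r) (w t)%:C%C *: A t) L = \sum_(t <- r) w t * rtr (A t) L.
Proof.
rewrite /rtr mulmx_suml -[LHS]/(part true _) raddf_sum part_sum /=.
apply: eq_bigr => t _.
by rewrite -scalemxAl linearZ /= -[LHS]/(part true _) part_realM.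
Qed.

End Decomposition.

(** * From combinations to plans, from functionals to dual pairs *)

Section Plans.
Variables (R : realType) (n : nat).
Local Notation C := R[i].
Local Notation V := ('cV[C]_n * 'cV[C]_n)%type.

(** A plan is a set, in which equal triples would count once, and its weights are positive; so the
    weights of equal points are added and null points discarded. *)
Lemma merge_plan N (w : 'I_N -> R) (s : 'I_N -> V) : (forall k, 0 <= w k) ->
  exists e : plan R n,
    (forall x u v, (x, u, v) \in e -> 0 < x /\ exists k, s k = (u, v)) /\
    forall F : V -> R, \sum_(t <- e) t.1.1 * F (t.1.2, t.2) = \sum_k w k * F (s k).
Proof.
move=> w0.
pose W z := \sum_(k | s k == z) w k.
pose h (z : V) : R * 'cV[C]_n * 'cV[C]_n := (W z, z.1, z.2).
have h_inj : injective h by case=> [u v] [u' v'] [_ -> ->].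
pose r := undup [seq s k | k <- enum 'I_N & 0 < w k].
exists (seq_fset tt (map h r)); split.
  move=> x u v; rewrite seq_fsetE => /mapP[z]; rewrite mem_undup => /mapP[k].
  rewrite mem_filter => /andP[wk _] -> [-> -> ->]; split.
    by rewrite /W (bigD1 k)//= ltr_pwDl// sumr_ge0.
  by exists k; case: (s k).
move=> F.
have -> : \sum_(t <- seq_fset tt (map h r)) t.1.1 * F (t.1.2, t.2) =
    \sum_(t <- map h r) t.1.1 * F (t.1.2, t.2).
  apply: perm_big; apply: uniq_perm.
  - exact: fset_uniq.
  - by rewrite map_inj_uniq// undup_uniq.
  - by move=> t; rewrite seq_fsetE.
rewrite big_map /=.
have -> : \sum_(z <- r) W z * F (z.1, z.2) =
    \sum_(z <- r) \sum_k if s k == z then w k * F (s k) else 0.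
  apply: eq_bigr => -[u v] _; rewrite /W mulr_suml big_mkcond /=.
  by apply: eq_bigr => k _; case: eqP => [->|_]; rewrite ?mul0r.
rewrite exchange_big /=; apply: eq_bigr => k _.
rewrite -big_mkcond; under eq_bigl do rewrite eq_sym.
(* A null weight contributes nothing, whether or not its point is in [r]; a point of positive weight
   occurs in [r] exactly once. *)
have := w0 k; rewrite le_eqVlt => /orP[/eqP <-|wk].
  by rewrite mul0r big1// => z _; rewrite mul0r.
rewrite -big_filter filter_pred1_uniq ?undup_uniq ?big_seq1// mem_undup.
by apply: map_f; rewrite mem_filter wk mem_enum.
Qed.

Lemma weak_duality_plan (rho nu L G : 'M[C]_n) e :
  is_plan rho nu e -> dual_feasible L G -> dual_objective rho nu L G <= T2 e.
Proof.
move=> [eP _ <- <-] [hL hG LG].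
rewrite /dual_objective raddfD /= -[leLHS]/(part true _) partD /=.
rewrite -!/(rtr _ _) !rtr_sum -big_split /= /T2.
rewrite big_seq [leRHS]big_seq; apply: ler_sum => -[[w u] v] /eP[w0 u1 v1] /=.
rewrite -mulrDr ler_wpM2l ?(ltW w0)//.
have := LG _ _ u1 v1.
rewrite costE !quad_outer !tr_hermsymmx ?hermsymmx_outer// -!rmorphB ler0c.
by rewrite -addrA -opprD subr_ge0.
Qed.

Definition target (rho nu : 'M[C]_n) (k : bool * bool * 'I_n * 'I_n) : R :=
  part k.1.1.2 ((if k.1.1.1 then rho else nu) k.1.2 k.2).

(** Stated for arbitrary [A] and [B] because it serves twice: for [rho] and [nu], and for [outer x]
    and [outer y], whose targets are the values of [entry] at (x, y). *)
Lemma sum_entry (l : bool * bool * 'I_n * 'I_n -> R) (A B : 'M[C]_n) :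
  \sum_k l k * target A B k =
  rtr A (rep_mx (fun r i j => l (true, r, i, j))) +
  rtr B (rep_mx (fun r i j => l (false, r, i, j))).
Proof.
rewrite !rtr_rep_mx.
have -> : \sum_k l k * target A B k = \sum_s \sum_r \sum_i \sum_j
    l (s, r, i, j) * target A B (s, r, i, j).
  by rewrite !pair_big; apply: eq_bigr => -[[[s r] i] j].
have E s (M : 'M[C]_n) : (if s then A else B) = M ->
    \sum_r \sum_i \sum_j l (s, r, i, j) * target A B (s, r, i, j) =
    \sum_i \sum_j \sum_r l (s, r, i, j) * part r (M i j).
  move=> <-; rewrite exchange_big /=; apply: eq_bigr => i _.
  by rewrite exchange_big.
by rewrite big_bool (E true A)// (E false B).
Qed.

Lemma dual_of_functional (rho nu : 'M[C]_n) (a : R)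
    (l : bool * bool * 'I_n * 'I_n -> R) : qstate rho -> qstate nu ->
  (forall z, @spheres R n z ->
     a + \sum_k l k * (entry k z - target rho nu k) <= rcost z.1 z.2) ->
  exists L G, dual_feasible L G /\ dual_objective rho nu L G = a.
Proof.
move=> [rho_herm _ rho1] [nu_herm _ nu1] le_cost.
pose M s := herm_part (rep_mx (fun r i j => l (s, r, i, j))).
(* The constant term of the affine minorant; as [rho] and [outer x] have trace 1, adding [b] times
   the identity to the first matrix accounts for it. *)
pose b := a - \sum_k l k * target rho nu k.
have M_herm s : M s \is hermsymmx by exact: hermsymmx_herm_part.
have Mb_herm : M true + (b%:C%C)%:M \is hermsymmx.
  exact: hermsymmxD (M_herm _) (hermsymmx_real_scalar _ _).
have eval (A B : 'M[C]_n) : A \is hermsymmx -> B \is hermsymmx -> \tr A = 1 ->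
    rtr A (M true + (b%:C%C)%:M) + rtr B (M false) =
    \sum_k l k * target A B k + b.
  by move=> hA hB A1; rewrite sum_entry rtrDr rtr_scalar// !rtr_herm_part// addrAC.
exists (M true + (b%:C%C)%:M), (M false); split; last first.
  rewrite /dual_objective raddfD /= -[LHS]/(part true _) partD /= -!/(rtr _ _).
  by rewrite eval// /b addrC subrK.
split=> // x y x1 y1.
rewrite costE !quad_outer !tr_hermsymmx ?hermsymmx_outer// -!rmorphB ler0c.
rewrite -addrA -opprD subr_ge0 eval ?hermsymmx_outer ?tr_outer//.
apply: le_trans (le_cost (x, y) _); last by split.
rewrite /b addrC -addrA lerD2l -sumrN -big_split /= ler_sum// => -[[[s r] i] j] _.
by rewrite mulrBr addrC; case: s.
Qed.

End Plans.

(** * Attainment by a plan and by a measure *)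

Section Attainment.
Variables (R : realType) (n : nat).
Local Notation C := R[i].
Local Notation V := ('cV[C]_n * 'cV[C]_n)%type.
Local Notation params := (prod_topology (fun _ : bool * bool * 'I_n => R : topologicalType)).
Local Notation Sp := (of_params @^-1` @spheres R n).

(** The product coupling of the two spectral decompositions has the required marginals. *)
Lemma target_in_hull (rho nu : 'M[C]_n) : qstate rho -> qstate nu ->
  exists N, in_hull Sp (fun k => entry k \o of_params) (target rho nu) N.
Proof.
move=> /qstate_decomposition[w [u [w0 u1 w1 rhoE]]].
move=> /qstate_decomposition[w' [v [w'0 v1 w'1 nuE]]].
eexists; apply: (in_hull_fin (w := fun k : 'I_n * 'I_n => w k.1 * w' k.2)
  (s := fun k => to_params (u k.1, v k.2))).
- by move=> k; rewrite mulr_ge0.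
- by move=> k; rewrite /preimage /= to_paramsK; split; [exact: u1|exact: v1].
- rewrite -(pair_big xpredT xpredT (fun i j => w i * w' j)) /=.
  by under eq_bigr do rewrite -mulr_sumr w'1 mulr1.
move=> [[[s r] i] j].
under eq_bigr do rewrite /= to_paramsK.
rewrite -(pair_big xpredT xpredT (fun k l => w k * w' l * entry (s, r, i, j) (u k, v l))) /=.
rewrite /entry /target /=; case: s => /=.
  rewrite rhoE summxE part_sum; apply: eq_bigr => k _.
  by rewrite [in RHS]mxE part_realM -mulr_suml -mulr_sumr w'1 mulr1.
rewrite exchange_big /= nuE summxE part_sum; apply: eq_bigr => k _.
by rewrite [in RHS]mxE part_realM -mulr_suml -[in LHS]mulr_suml w1 mul1r.
Qed.

Variables (rho nu : 'M[C]_n) (N : nat) (c : 'I_N -> R * params).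
Hypothesis Kc : barycentric Sp c.
Hypothesis c_target : forall k, mean c (entry k \o of_params) = target rho nu k.

Lemma plan_of_combination :
  exists2 e, is_plan rho nu e & T2 e = mean c (fun t => rcost (of_params t).1 (of_params t).2).
Proof.
have [w0 Sc w1] := Kc.
have [e [e_in e_sum]] := merge_plan (fun k => of_params (c k).2) w0.
exists e; last exact: (e_sum (fun z => rcost z.1 z.2)).
split.
- move=> x u v /e_in[x0 [k ck]]; split=> //.
    by have [] := Sc k; rewrite ck.
  by have [] := Sc k; rewrite ck.
- have := e_sum (fun=> 1); under eq_bigr do rewrite mulr1.
  by move=> ->; under eq_bigr do rewrite mulr1.
- apply: sum_scale_eq => q i j.
  by rewrite (e_sum (entry (true, q, i, j))) [LHS]c_target.
- apply: sum_scale_eq => q i j.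
  by rewrite (e_sum (entry (false, q, i, j))) [LHS]c_target.
Qed.

Lemma measure_of_combination :
  exists2 mu : {finite_measure set (borel_pair R n) -> \bar R},
    primal_feasible rho nu mu &
    primal_objective mu = (mean c (fun t => rcost (of_params t).1 (of_params t).2))%:E.
Proof.
have [w0 Sc w1] := Kc.
have N_gt0 : (0 < N)%N.
  case: posnP => // N0; move/eqP: w1; rewrite big1 1?eq_sym ?oner_eq0// => i.
  by have := ltn_ord i; rewrite [in X in (_ < X)%N]N0.
(* [discrete_measure] is indexed by [nat]; indices from [N] on get a default value that its sum
   never reaches. *)
pose f : nat -> 'I_N := insubd (Ordinal N_gt0).
pose w k := NngNum (w0 (f k)).
pose p k : borel_pair R n := of_params (c (f k)).2.
have pS k : spheres (p k) by exact: Sc.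
have int F : regular F -> \int[discrete_measure N w p]_(z in @spheres R n) F z =
    mean c (F \o of_params).
  by move=> rF; rewrite integral_discrete//; apply: eq_bigr => k _; rewrite /p /= /f valKd.
exists (discrete_measure N w p).
  split; first exact: discrete_measureC.
    apply/matrixP => i j; rewrite mxE; apply: (@part_inj R) => q.
    transitivity (target rho nu (true, q, i, j)) => //; rewrite -c_target -int.
      by case: q.
    exact: regular_entry.
  apply/matrixP => i j; rewrite mxE; apply: (@part_inj R) => q.
  transitivity (target rho nu (false, q, i, j)) => //; rewrite -c_target -int.
    by case: q.
  exact: regular_entry.
rewrite primal_objectiveE int//; exact: regular_rcost.
Qed.

End Attainment.

Unset Implicit Arguments.

(* The infimum over plans, P and D are computed in \bar R; the first conjunct
   says that their common value is a real number, so that W2 is not a square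
   root of a default value. *)
Theorem theorem8 (R : realType) (n : nat) (n_gt0 : (0 < n)%N)
    (rho nu : 'M[R[i]]_n) (rho_state : qstate rho) (nu_state : qstate nu) :
  exists p : R,
    [/\ T2_inf rho nu = p%:E,
        W2 rho nu ^+ 2 = (p%:C)%C,
        primal_value rho nu = p%:E,
        (exists mu : {finite_measure set (borel_pair R n) -> \bar R},
            primal_feasible rho nu mu /\
            primal_objective mu = primal_value rho nu)
      & dual_value rho nu = p%:E].
Proof.
have [||||N [c [Kc c_target c_dual]]] :=
    @moment_duality R _ (of_params @^-1` @spheres R n) _
      (fun k => entry k \o of_params) (fun t => rcost (of_params t).1 (of_params t).2)
      (target rho nu).
- exact: compact_spheres_params.
- by move=> k; apply: regular_of_params; exact: regular_entry.
- exact: (regular_of_params (@regular_rcost R n)).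
- exact: target_in_hull.
set p := mean c _ in c_dual; exists p.
have dual_eps eps : 0 < eps -> exists L G, dual_feasible L G /\
    dual_objective rho nu L G = p - eps.
  move=> /c_dual[l le_l]; apply: (@dual_of_functional _ _ _ _ _ l) => // z Sz.
  have Sz' : (of_params @^-1` @spheres R n) (to_params z) by rewrite /preimage /= to_paramsK.
  have : p - eps + \sum_k l k * (entry k (of_params (to_params z)) - target rho nu k) <=
      rcost (of_params (to_params z)).1 (of_params (to_params z)).2 := le_l _ Sz'.
  by rewrite to_paramsK.
have [e eP eT] := plan_of_combination Kc c_target.
have [mu muP muE] := measure_of_combination Kc c_target.
rewrite -/p in eT muE.
(* Dual values [p - eps] exist for every positive [eps], so any upper bound of the dual values is at
   least [p]. *)
have le_of_dual (x : \bar R) : (forall L G, dual_feasible L G ->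
    ((dual_objective rho nu L G)%:E <= x)%E) -> (p%:E <= x)%E.
  move=> h; apply/lee_subgt0Pr => eps eps0.
  by have [L [G [LG LGp]]] := dual_eps eps eps0; rewrite -EFinB -LGp; exact: h.
have T2E : T2_inf rho nu = p%:E.
  apply/eqP; rewrite eq_le; apply/andP; split.
    by apply: ereal_inf_lbound; exists e => //; rewrite eT.
  apply: le_ereal_inf_tmp => _ [e' e'P <-]; apply: le_of_dual => L G LG.
  by rewrite lee_fin; exact: weak_duality_plan e'P LG.
have PE : primal_value rho nu = p%:E.
  apply/eqP; rewrite eq_le; apply/andP; split.
    by apply: ereal_inf_lbound; exists mu.
  apply: le_ereal_inf_tmp => _ [mu' mu'P <-]; apply: le_of_dual => L G LG.
  exact: weak_duality mu'P LG.
split=> //.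
(* The complex square root squares back to [p] whatever the sign of [p]. *)
- by rewrite /W2 T2E sqrtCK.
- by exists mu; split=> //; rewrite PE.
(* Weak duality against the optimal [mu] bounds every dual value by [p]. *)
apply/eqP; rewrite eq_le; apply/andP; split.
  apply: ge_ereal_sup => _ [[L G] /= LG <-]; rewrite -muE.
  exact: weak_duality muP LG.
apply: le_of_dual => L G LG; apply: ereal_sup_ubound.
by exists (L, G).
Qed.
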